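(* Assume $D$ is totally transcendental. Let $B\subseteq\mathfrak C$ and let $\bar a,\bar c$ be finite sequences in $\mathfrak C$ such that $\operatorname{tp}(\bar a,B)$ and $\operatorname{tp}(\bar c,B)$ are stationary. Then $\bar a\perp_B\bar c$ if and only if $\bar c\perp_B\bar a$.
   Context: Setting. $T$ is a first-order theory in a language $L(T)$ (with $|T|$ infinite: the number of $L(T)$-formulas), $\overline M$ is a very large saturated model of $T$; all sets are subsets of $\overline M$, all models are elementary submodels of $\overline M$. Barred letters are finite sequences; $\bar a\in A$ means all entries lie in $A$. $\operatorname{tp}(\bar c,A)$ is the complete type of $\bar c$ over $A$ in $\overline M$. $D(T)$ is the set of complete types over $\emptyset$ in finitely many variables. For a set of formulas $p$, $\operatorname{dom}(p)$ is the set of its parameters, $p$ is over $A$ if $\operatorname{dom}(p)\subseteq A$, and $p\restriction B$ is the set of formulas of $p$ with parameters in $B$. Fix $D\subseteq D(T)$. $A$ is a $D$-set if $\operatorname{tp}(\bar c,\emptyset)\in D$ for all $\bar c\in A$; a $D$-model is a model whose universe is a $D$-set. $S_D(A)$ is the set of complete types $p$ over $A$ (in finitely many variables) such that $A\cup\bar c$ is a $D$-set whenever $\bar c\models p$. A $D$-model $M$ is $(D,\lambda)$-homogeneous if it realizes every $p\in S_D(A)$ with $A\subseteq M$, $|A|<\lambda$. Standing hypothesis: $\mathfrak{C}$ is a fixed $(D,\chi)$-homogeneous model (of cardinality at least $\chi$), where $\chi$ is larger than all cardinals considered; all $D$-sets and $D$-models other than $\mathfrak C$ are subsets (elementary submodels)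 of $\mathfrak C$ of cardinality less than $\chi$. Rank. Let $A\subseteq\mathfrak C$. For a set of formulas $p(\bar x,\bar b)$ with parameters in a finite $\bar b\in A$, define $R_A[p]\ge\alpha$ by induction: $R_A[p]\ge0$ if $p$ is realized in $\mathfrak C$; for limit $\delta$, $R_A[p]\ge\delta$ if $R_A[p]\ge\alpha$ for all $\alpha<\delta$; $R_A[p]\ge\alpha+1$ if (a) there are $\bar a\in A$ and a formula $\phi(\bar x,\bar y)$ with $R_A[p\cup\{\phi(\bar x,\bar a)\}]\ge\alpha$ and $R_A[p\cup\{\neg\phi(\bar x,\bar a)\}]\ge\alpha$, and (b) for every $\bar a\in A$ there is $q(\bar x,\bar y)\in D$ with $R_A[p\cup q(\bar x,\bar a)]\ge\alpha$. $R_A[p]=-1$ if $p$ is not realized in $\mathfrak C$; $R_A[p]=\alpha$ if $R_A[p]\ge\alpha$ but not $R_A[p]\ge\alpha+1$; $R_A[p]=\infty$ if $R_A[p]\ge\alpha$ for all ordinals $\alpha$. For arbitrary $p$ over $A$, $R_A[p]=\min\{R_A[q]: q\subseteq p\restriction B,\ B\subseteq\operatorname{dom}(p)\text{ finite}\}$. $R[p]$ means $R_{\mathfrak C}[p]$. $D$ is totally transcendental if $R_A[p]<\infty$ for every $A\subseteq\mathfrak C$ and every type $p$ over $A$. A type $p$ is stationary if for every $B\supseteq\operatorname{dom}(p)$ there is a unique $p_B\in S_D(B)$ extending $p$ with $R[p_B]=R[p]$. Independence: $\bar a\perp_B\bar c$ means $R[\operatorname{tp}(\bar a,B)]=R[\operatorname{tp}(\bar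 a,B\cup\bar c)]$. *)

(* Defs.v *)
From HB Require Import structures.
From mathcomp Require Import all_boot.
From mathcomp Require Import boolp classical_sets functions cardinality.

Set Implicit Arguments.
Unset Strict Implicit.
Unset Printing Implicit Defensive.

Local Open Scope classical_set_scope.
Local Open Scope card_scope.

(** * First-order logic *)

Record language := Language {
  func : Type;
  farity : func -> nat;
  relsym : Type;
  rarity : relsym -> nat
}.

Inductive term (L : language) (n : nat) : Type :=
| Var of 'I_n
| App (f : func L) of 'I_(farity f) -> term L n.

(* [form L n]: L-formulas with free variables among x_0, ..., x_(n-1).  The
   quantifier binds x_0 and shifts the other variables. *)
Inductive form (L : language) : nat -> Type :=
| Bot n : form L n
| Eq n : term L n -> term L n -> form L n
| Rel n (r : relsym L) : ('I_(rarity r) -> term L n) -> form L n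
| Imp n : form L n -> form L n -> form L n
| All n : form L n.+1 -> form L n.

Arguments Bot {L n}.

Definition Neg L n (phi : form L n) : form L n := Imp phi Bot.

Record structure (L : language) := Structure {
  carrier :> Type;
  carrier_inh : inhabited carrier;
  finterp : forall f : func L, (farity f).-tuple carrier -> carrier;
  pinterp : forall r : relsym L, (rarity r).-tuple carrier -> Prop
}.

Fixpoint eval L (M : structure L) n (v : n.-tuple M) (t : term L n) : M :=
  match t with
  | Var i => tnth v i
  | App f ts => finterp [tuple eval v (ts i) | i < farity f]
  end.

Fixpoint sat L (M : structure L) n (phi : form L n) : n.-tuple M -> Prop :=
  match phi in form _ n return n.-tuple M -> Prop with
  | Bot _ => fun _ => False
  | Eq _ s t => fun v => eval v s = eval v t
  | Rel _ r ts => fun v => pinterp [tuple eval v (ts i) | i < rarity r]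
  | Imp _ phi psi => fun v => sat phi v -> sat psi v
  | All _ phi => fun v => forall a : M, sat phi (cons_tuple a v)
  end.

Definition models L (M : structure L) (T : set (form L 0)) : Prop :=
  forall phi, T phi -> sat phi ([tuple] : 0.-tuple M).

Definition elementary L (N M : structure L) (h : N -> M) : Prop :=
  forall n (phi : form L n) (v : n.-tuple N),
    sat phi v <-> sat phi (map_tuple h v).

Definition elementary_submodel L (M : structure L) (C : set M) : Prop :=
  exists (N : structure L) (h : N -> M), elementary h /\ range h = C.

(* tp(c, 0) *)
Definition tp0 L (M : structure L) n (c : n.-tuple M) : set (form L n) :=
  [set phi | sat phi c].

(* D(T) *)
Definition types_of L (T : set (form L 0)) n : set (set (form L n)) :=
  [set p | exists (N : structure L) (c : n.-tuple N), models N T /\ p = tp0 c].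

Definition card_lt (U V : Type) (A : set U) (B : set V) : Prop :=
  A #<= B /\ ~ (B #<= A).

(** * Ordinals *)

(* Every ordinal is 0, a successor or the supremum of a nonempty family of
   smaller ordinals.  The families are not required to be increasing, so an
   ordinal has many notations; the rank below depends only on its value. *)
Inductive ord : Type :=
| ord0
| ordS of ord
| ord_sup (J : Type) of inhabited J & (J -> ord).

(** * Formulas and types with parameters *)

Section Types.
Variables (L : language) (M : structure L).

(* phi(x, a), where x has length n and a is a finite sequence in M *)
Record pform (n : nat) : Type := PForm {
  npar : nat;
  pmatrix : form L (n + npar);
  params : npar.-tuple M
}.

Definition entries n (a : n.-tuple M) : set M := range (tnth a).

Definition psat n (phi : pform n) (c : n.-tuple M) : Prop :=
  sat (pmatrix phi) (cat_tuple c (params phi)).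

Definition pneg n (phi : pform n) : pform n :=
  PForm (Neg (pmatrix phi)) (params phi).

(* q(x, a) *)
Definition inst n m (q : set (form L (n + m))) (a : m.-tuple M) :
  set (pform n) := [set PForm phi a | phi in q].

Definition dom n (p : set (pform n)) : set M :=
  \bigcup_(phi in p) entries (params phi).

Definition restr n (p : set (pform n)) (B : set M) : set (pform n) :=
  [set phi | p phi /\ entries (params phi) `<=` B].

Definition realizes n (c : n.-tuple M) (p : set (pform n)) : Prop :=
  forall phi, p phi -> psat phi c.

(* Consistent with the elementary diagram of M; M is the monster model in the
   sequel. *)
Definition type_over (A : set M) n (p : set (pform n)) : Prop :=
  dom p `<=` A /\
  forall F, finite_set F -> F `<=` p -> exists c : n.-tuple M, realizes c F.

Definition complete_type (A : set M) n (p : set (pform n)) : Prop :=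
  type_over A p /\
  forall phi, entries (params phi) `<=` A -> p phi \/ p (pneg phi).

Definition tp n (c : n.-tuple M) (A : set M) : set (pform n) :=
  [set phi | entries (params phi) `<=` A /\ psat phi c].

Definition saturated : Prop :=
  forall A : set M, card_lt A [set: M] ->
  forall n (p : set (pform n)), type_over A p -> exists c, realizes c p.

(** * Finite diagrams *)

Variable D : forall n, set (set (form L n)).

Definition D_set (A : set M) : Prop :=
  forall n (c : n.-tuple M), entries c `<=` A -> D (tp0 c).

Definition S_D (A : set M) n : set (set (pform n)) :=
  [set p | complete_type A p /\
           forall c, realizes c p -> D_set (A `|` entries c)].

Definition D_model (C : set M) : Prop := elementary_submodel C /\ D_set C.

(* A cardinal is given by a type [chi] of that cardinality. *)
Definition D_homogeneous (chi : Type) (C : set M) : Prop :=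
  D_model C /\
  forall A : set M, A `<=` C -> card_lt A [set: chi] ->
  forall n (p : set (pform n)), S_D A p ->
  exists2 c, entries c `<=` C & realizes c p.

(** * Rank *)

Variable C : set M.

(* R_A[p] >= alpha for p with finitely many parameters *)
Fixpoint finrank_ge (A : set M) n (p : set (pform n)) (alpha : ord) : Prop :=
  match alpha with
  | ord0 => exists2 c, entries c `<=` C & realizes c p
  | ordS beta =>
      (exists m (phi : form L (n + m)) (a : m.-tuple M),
         [/\ entries a `<=` A,
             finrank_ge A (p `|` [set PForm phi a]) beta
           & finrank_ge A (p `|` [set PForm (Neg phi) a]) beta]) /\
      (forall m (a : m.-tuple M), entries a `<=` A ->
         exists2 q, D q & finrank_ge A (p `|` inst q a) beta)
  | ord_sup J _ f => forall i : J, finrank_ge A p (f i)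
  end.

(* R_A[p] >= alpha: the minimum of a set of ranks is >= alpha iff all its
   members are. *)
Definition rank_ge (A : set M) n (p : set (pform n)) (alpha : ord) : Prop :=
  forall B q, B `<=` dom p -> finite_set B -> q `<=` restr p B ->
  finrank_ge A q alpha.

(* R_A[p] = infinity *)
Definition rank_infinite (A : set M) n (p : set (pform n)) : Prop :=
  forall alpha, rank_ge A p alpha.

(* R[p] = R[q], where R is R_C: an element of {-1} u Ord u {infinity} is
   determined by the ordinals below or equal to it. *)
Definition eq_rank n (p q : set (pform n)) : Prop :=
  forall alpha, rank_ge C p alpha <-> rank_ge C q alpha.

Definition totally_transcendental : Prop :=
  forall A : set M, A `<=` C ->
  forall n (p : set (pform n)), type_over A p -> ~ rank_infinite A p.

Definition stationary (chi : Type) n (p : set (pform n)) : Prop :=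
  forall B : set M, B `<=` C -> card_lt B [set: chi] -> dom p `<=` B ->
  exists! pB, [/\ S_D B pB, p `<=` pB & eq_rank pB p].

Definition indep n m (a : n.-tuple M) (B : set M) (c : m.-tuple M) : Prop :=
  eq_rank (tp a B) (tp a (B `|` entries c)).

(* [ord] is long enough: some alpha bounds all ranks other than infinity.  In
   particular the universe of index types in [ord_sup] contains the sets of
   formulas over M. *)
Lemma finrank_stabilizes : exists alpha, forall (A : set M) n (p : set (pform n)),
  finrank_ge A p alpha -> forall beta, finrank_ge A p beta.
Proof.
pose J := ((M -> Prop) * {n : nat & pform n -> Prop})%type.
have /choice[g gP] : forall j : J, exists al,
    finrank_ge j.1 (projT2 j.2) al ->
    forall beta, finrank_ge j.1 (projT2 j.2) beta.
  move=> [A [n p]] /=.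
  have [[b bP]|nb] := pselect (exists b, ~ finrank_ge A p b); first by exists b.
  by exists ord0 => _ b; apply: contrapT => bN; apply: nb; exists b.
exists (@ord_sup J (inhabits (set0, existT _ 0 set0)) g) => A n p h.
exact: (gP (A, existT _ n p) (h (A, existT _ n p))).
Qed.

End Types.

(* Main.v *)
Require Import Defs.
From mathcomp Require Import all_boot.
From mathcomp Require Import boolp classical_sets functions cardinality.
From mathcomp Require Import order ssralg ssrnum rat.

(* Suppose [a] is independent from [c] over [B] but [c] is not independent from
   [a].  Stationarity and homogeneity give a Morley sequence (a_i, c_i) over
   [B]: a_i realizes the stationary extension of tp(a, B) over B_i, the union of
   [B] and the earlier pairs, and c_i that of tp(c, B) over B_i a_i.  For j < i,
   (a_i, c_j) has the type of (a, c) over [B], and for i <= j it does not, so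
   some formula over [B] orders the sequence.  Compactness is not available
   inside [C], but the sequence is indiscernible over [B], so homogeneity
   stretches it to a sequence indexed by the rationals, adding one pair at a
   time along an enumeration.  Over the union of [B] and this sequence, every set
   of formulas realized by all a_t with t in a given open interval has infinite
   rank: the order splits it at a midpoint, and a subinterval avoiding finitely
   many points carries a constant type over them.  This contradicts total
   transcendence. *)

Set Implicit Arguments.
Unset Strict Implicit.
Unset Printing Implicit Defensive.

Local Open Scope classical_set_scope.
Local Open Scope card_scope.
Import Order.TTheory.

(** * Cardinality *)

(** Hilbert's hotel: along a copy [h] of the natural numbers in [A], the map [g] sends [h k.+1] to
    [h k] and [h 0] to [x] and fixes the rest, so the image of [A] covers [x] too. *)
Lemma infinite_setU1_card_le T (A : set T) x : infinite_set A -> A `|` [set x] #<= A.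
Proof.
move=> /infiniteP/card_leP[f].
pose h k : T := val (f (to_setT k)).
have hA k : A (h k) by exact: set_mem (valP (f (to_setT k))).
have h_inj i j : h i = h j -> i = j.
  by move=> /val_inj /(@inj _ _ _ f) e; have [] := e (mem_set Logic.I) (mem_set Logic.I).
pose g y := if pselect (exists k, h k.+1 = y) is left e then h (projT1 (cid e))
            else if pselect (y = h 0) then x else y.
apply: card_le_trans (card_image_le g A); apply: subset_card_le => y [Ay|->].
  have [[k ky]|ny] := pselect (exists k, h k = y).
    exists (h k.+1) => //; rewrite /g; case: pselect => [e|[]]; last by exists k.
    by case: (cid e) => j /= /h_inj [->].
  exists y => //; rewrite /g; case: pselect => [[k ky]|_]; first by case: ny; exists k.+1.
  by case: pselect => // y0; case: ny; exists 0.
exists (h 0) => //; rewrite /g; case: pselect => [[k /h_inj //]|_].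
by case: pselect.
Qed.

Lemma card_ltU_finite U V (A : set U) (B : set V) (F : set U) :
  infinite_set B -> card_lt A B -> finite_set F -> card_lt (A `|` F) B.
Proof.
move=> Binf [AB BA] Ff.
have [Af|Ainf] := pselect (finite_set A).
  have AFf : finite_set (A `|` F) by rewrite finite_setU.
  split=> [|/card_le_finite/(_ AFf)//].
  move: AFf => /finite_set_leP[k] /card_le_trans; apply.
  move/infiniteP: Binf; apply: card_le_trans.
  exact/subset_card_le/subsetT.
suff AFA : A `|` F #<= A.
  by split; [exact: card_le_trans AB | move=> /card_le_trans/(_ AFA)].
have /finite_seqP[s ->] : finite_set (F : set {classic U}) by [].
elim: s => [|x s IH]; first by rewrite (_ : [set` [::]] = set0) ?setU0// predeqE.
rewrite (_ : [set` x :: s] = [set` s] `|` [set x]); last first.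
  rewrite predeqE => y /=; rewrite inE; split=> [/orP[/eqP->|]|[->|->]].
  - by right.
  - by left.
  - exact: orbT.
  - by rewrite eqxx.
rewrite setUA; apply: card_le_trans IH; apply: infinite_setU1_card_le.
by apply: sub_infinite_set Ainf; left.
Qed.

(** * Renaming of variables *)

Section Renaming.
Variable L : language.

Fixpoint rename_term n m (r : 'I_n -> 'I_m) (t : term L n) : term L m :=
  match t with
  | Var i => Var L (r i)
  | App f ts => App (fun i => rename_term r (ts i))
  end.

Definition lift_renaming n m (r : 'I_n -> 'I_m) (i : 'I_n.+1) : 'I_m.+1 :=
  if unlift ord0 i is Some j then lift ord0 (r j) else ord0.

Fixpoint rename n (phi : form L n) : forall m, ('I_n -> 'I_m) -> form L m :=
  match phi with
  | Bot _ => fun m r => Bot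
  | Eq _ s t => fun m r => Eq (rename_term r s) (rename_term r t)
  | Rel _ R ts => fun m r => Rel (fun i => rename_term r (ts i))
  | Imp _ phi psi => fun m r => Imp (rename phi r) (rename psi r)
  | All _ phi => fun m r => All (rename phi (lift_renaming r))
  end.

Variable M : structure L.

Lemma eval_rename n m (r : 'I_n -> 'I_m) (t : term L n) (v : m.-tuple M) :
  eval v (rename_term r t) = eval [tuple tnth v (r i) | i < n] t.
Proof.
elim: t => [i|f ts IH] /=; first by rewrite tnth_mktuple.
by congr finterp; apply: eq_from_tnth => i; rewrite !tnth_mktuple.
Qed.

Lemma tnth_cons_lift n (x : M) (v : n.-tuple M) (i : 'I_n) :
  tnth (cons_tuple x v) (lift ord0 i) = tnth v i.
Proof. by rewrite !(tnth_nth x). Qed.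

Lemma sat_rename n (phi : form L n) m (r : 'I_n -> 'I_m) (v : m.-tuple M) :
  sat (rename phi r) v <-> sat phi [tuple tnth v (r i) | i < n].
Proof.
elim: phi m r v => {n} [n|n s t|n R ts|n phi IHp psi IHq|n phi IH] m r v //=.
- by rewrite !eval_rename.
- suff -> : [tuple eval v (rename_term r (ts i)) | i < rarity R] =
     [tuple eval [tuple tnth v (r j) | j < n] (ts i) | i < rarity R] by [].
  by apply: eq_from_tnth => i; rewrite !tnth_mktuple eval_rename.
- by rewrite IHp IHq.
- suff e x : [tuple tnth (cons_tuple x v) (lift_renaming r i) | i < n.+1] =
    cons_tuple x [tuple tnth v (r i) | i < n].
    by split=> H x; have := H x; rewrite IH e.
  apply: eq_from_tnth => i; rewrite tnth_mktuple /lift_renaming.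
  case: unliftP => [j ->|->]; last by rewrite !tnth0.
  by rewrite !tnth_cons_lift tnth_mktuple.
Qed.

Definition form_conj n (phi psi : form L n) : form L n := Neg (Imp phi (Neg psi)).

Lemma sat_conj n (phi psi : form L n) (v : n.-tuple M) :
  sat (form_conj phi psi) v <-> sat phi v /\ sat psi v.
Proof.
split=> /= [H|[Hp Hq] H]; last exact: H.
by split; apply: contrapT => N; apply: H => // ?.
Qed.

(** The tuple realizing a formula occupies the first variables, so a leading block is what has to be
    quantified away. The annotation on [phi] relies on [n'.+1 + k] being convertible to
    [(n' + k).+1]. *)
Fixpoint exists_block n k : form L (n + k) -> form L k :=
  if n is n'.+1 return form L (n + k) -> form L k
  then fun phi => exists_block (Neg (All (Neg (phi : form L (n' + k).+1))))
  else id.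

Lemma sat_exists_block n k (phi : form L (n + k)) (v : k.-tuple M) :
  sat (exists_block phi) v <-> exists c : n.-tuple M, sat phi (cat_tuple c v).
Proof.
have catE j (x : M) (c : j.-tuple M) :
    cat_tuple (cons_tuple x c) v = cons_tuple x (cat_tuple c v) by exact: val_inj.
elim: n phi => [|n IH] phi /=.
  have e (c : 0.-tuple M) : cat_tuple c v = v by apply: val_inj; rewrite /= (tuple0 c).
  by split=> [|[c]]; [exists [tuple]|]; rewrite e.
rewrite IH /=; split=> [[c H]|[c]].
  apply: contrapT => N; apply: H => x Hx; apply: N.
  by exists (cons_tuple x c); rewrite catE.
case/tupleP: c => x c; rewrite [cat_tuple _ _]catE => Hx.
by exists c => /(_ x); apply.
Qed.

End Renaming.

(** * Elementary maps and homogeneity *)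

Lemma map_tuple_surj X Y (g : X -> Y) k (t : k.-tuple Y) :
  range (tnth t) `<=` range g -> exists s : k.-tuple X, t = map_tuple g s.
Proof.
move=> tg; have /choice[h hP] i : exists x, g x = tnth t i.
  by have [|x _ xi] := tg (tnth t i); [exists i | exists x].
by exists [tuple h i | i < k]; apply: eq_from_tnth => i; rewrite tnth_map tnth_mktuple hP.
Qed.

Lemma entries_map X Y (g : X -> Y) k (s : k.-tuple X) : range (tnth (map_tuple g s)) `<=` range g.
Proof. by move=> _ [i _ <-]; rewrite tnth_map; exists (tnth s i). Qed.

Definition copair I J X (u : I -> X) (w : J -> X) (s : I + J) : X :=
  match s with inl i => u i | inr j => w j end.

Lemma range_copair I J X (u : I -> X) (w : J -> X) : range (copair u w) = range u `|` range w.
Proof.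
rewrite predeqE => x; split=> [[[i|j] _ <-]|[[i _ <-]|[j _ <-]]].
- by left; exists i.
- by right; exists j.
- by exists (inl i).
- by exists (inr j).
Qed.

Section TypeEquivalence.
Variables (L : language) (M : structure L).

(** Encodes the elementary map [u i |-> v i] by two families over one index type. Restricting or
    rearranging the map then amounts to composing with a map of indices. *)
Definition eqv I (u v : I -> M) : Prop := forall k (phi : form L k) (s : k.-tuple I),
  sat phi (map_tuple u s) <-> sat phi (map_tuple v s).

Lemma eqv_refl I (u : I -> M) : eqv u u.
Proof. by []. Qed.

Lemma eqv_sym I (u v : I -> M) : eqv u v -> eqv v u.
Proof. by move=> uv k phi s; rewrite uv. Qed.

Lemma eqv_trans I (u v w : I -> M) : eqv u v -> eqv v w -> eqv u w.
Proof. by move=> uv vw k phi s; rewrite uv vw. Qed.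

Lemma eqv_comp I J (h : J -> I) (u v : I -> M) : eqv u v -> eqv (u \o h) (v \o h).
Proof.
move=> uv k phi s; have e (w : I -> M) : map_tuple (w \o h) s = map_tuple w (map_tuple h s).
  by apply: val_inj; rewrite /= map_comp.
by rewrite !e.
Qed.

Lemma eqv_reindex I J (h : J -> I) (u v : I -> M) (u' v' : J -> M) :
  eqv u v -> u' =1 u \o h -> v' =1 v \o h -> eqv u' v'.
Proof. by move=> uv /funext -> /funext ->; exact: eqv_comp. Qed.

Lemma eqv_inj I (u v : I -> M) i j : eqv u v -> v i = v j -> u i = u j.
Proof.
move=> uv vij; have := uv 2 (Eq (Var L ord0) (Var L (lift ord0 ord0))) [tuple i; j].
by rewrite /= !tnth_map !(tnth_nth i) /= => -[_]; apply.
Qed.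

(* [pform M n] with the parameters replaced by indices, so that one formula
   can be instantiated at two equivalent families. *)
Record iform (I : Type) (n : nat) : Type := IForm {
  ipar : nat;
  imatrix : form L (n + ipar);
  iidx : ipar.-tuple I
}.

Definition plug I n (u : I -> M) (f : iform I n) : pform M n :=
  PForm (imatrix f) (map_tuple u (iidx f)).

Definition ineg I n (f : iform I n) : iform I n := IForm (Neg (imatrix f)) (iidx f).

Definition ilift I J n (f : iform I n) : iform (I + J) n :=
  IForm (imatrix f) (map_tuple inl (iidx f)).

Lemma plug_lift I J n (u : I -> M) (w : J -> M) (f : iform I n) :
  plug (copair u w) (ilift J f) = plug u f.
Proof. by congr PForm; apply: val_inj; rewrite /= -map_comp. Qed.

Definition ivar I n m (phi : form L (n + m)) : iform (I + 'I_m) n :=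
  IForm phi (map_tuple inr (ord_tuple m)).

Lemma plug_var I n m (u : I -> M) (a : m.-tuple M) (phi : form L (n + m)) :
  plug (copair u (tnth a)) (ivar I phi) = PForm phi a.
Proof.
congr PForm; apply: eq_from_tnth => i.
by rewrite !tnth_map tnth_ord_tuple.
Qed.

Lemma plug_surj I n (u : I -> M) (phi : pform M n) :
  entries (params phi) `<=` range u -> exists f, phi = plug u f.
Proof.
by case: phi => k phi a /= /map_tuple_surj[s ->]; exists (IForm phi s).
Qed.

Definition iidx_copair I n (f : iform I n) : (n + ipar f).-tuple (I + 'I_n) :=
  cat_tuple (map_tuple inr (ord_tuple n)) (map_tuple inl (iidx f)).

Lemma psat_plug I n (u : I -> M) (f : iform I n) (w : n.-tuple M) :
  psat (plug u f) w <-> sat (imatrix f) (map_tuple (copair u (tnth w)) (iidx_copair f)).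
Proof.
rewrite /psat /=; suff -> : map_tuple (copair u (tnth w)) (iidx_copair f) =
  cat_tuple w (map_tuple u (iidx f)) by [].
apply: val_inj; rewrite /= map_cat -!map_comp; congr cat.
by rewrite -[RHS](map_tnth_enum w) -enumT.
Qed.

(** A formula whose arguments mix the two summands in any order is brought into the shape of [iform]
    by a renaming that depends on [s] only; hence one [f] serves all [u] and [w]. *)
Lemma sat_iform I n k (phi : form L k) (s : k.-tuple (I + 'I_n)) :
  exists f : iform I n, forall (u : I -> M) w,
    psat (plug u f) w <-> sat phi (map_tuple (copair u (tnth w)) s).
Proof.
have [m [idx [r rP]]] : exists m (idx : m.-tuple I) (r : 'I_k -> 'I_(n + m)), forall j,
    match tnth s j with inl i => exists2 l, r j = rshift n l & tnth idx l = i
                      | inr i => r j = lshift m i end.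
  (* [i0] fills the parameter slots of the positions that point into [w]. If [I] is empty, all
     positions do, and the list of parameters is empty. *)
  have [[i0]|noI] := pselect (inhabited I).
    exists k, (map_tuple (fun x => if x is inl i then i else i0) s).
    exists (fun j => match tnth s j with inl _ => rshift n j | inr i => lshift k i end) => j.
    by case e: (tnth s j) => [i|i] //; exists j => //; rewrite tnth_map e.
  exists 0, [tuple]; exists (fun j => match tnth s j with
    | inl i => False_rect _ (noI (inhabits i)) | inr i => lshift 0 i end) => j.
  by case: (tnth s j) => // i; case: noI.
exists (IForm (rename phi r) idx) => u w; rewrite /psat /= sat_rename.
suff -> : [tuple tnth (cat_tuple w (map_tuple u idx)) (r i) | i < k] =
  map_tuple (copair u (tnth w)) s by [].
apply: eq_from_tnth => j; rewrite tnth_mktuple tnth_map; have := rP j.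
case: (tnth s j) => [i [l -> <-]|i ->] /=; first by rewrite tnth_rshift tnth_map.
by rewrite tnth_lshift.
Qed.

Lemma eqv_copairP I n (u v : I -> M) (w w' : n.-tuple M) :
  eqv (copair u (tnth w)) (copair v (tnth w')) <->
  forall f : iform I n, psat (plug u f) w <-> psat (plug v f) w'.
Proof.
split=> [uv f|H k phi s]; first by rewrite !psat_plug.
by have [f fP] := sat_iform phi s; rewrite -!fP.
Qed.

Lemma iform_conj (X : eqType) I n (s : seq X) (h : X -> iform I n) :
  exists f : iform I n, forall (u : I -> M) w,
    psat (plug u f) w <-> forall x, x \in s -> psat (plug u (h x)) w.
Proof.
elim: s => [|x s [g gP]].
  by exists (IForm (Neg Bot) [tuple]) => u w; split=> // _; exact: id.
(* Each conjunct gets its own block of variables, for [w] as well as for its parameters. *)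
pose r1 i := lshift (n + ipar g) (i : 'I_(n + ipar (h x))).
pose r2 i := rshift (n + ipar (h x)) (i : 'I_(n + ipar g)).
have [f fP] := sat_iform (form_conj (rename (imatrix (h x)) r1) (rename (imatrix g) r2))
  (cat_tuple (iidx_copair (h x)) (iidx_copair g)).
exists f => u w; rewrite fP sat_conj !sat_rename.
set t := map_tuple _ _.
have -> : [tuple tnth t (r1 i) | i < _] = map_tuple (copair u (tnth w)) (iidx_copair (h x)).
  by apply: eq_from_tnth => i; rewrite tnth_mktuple !tnth_map tnth_lshift.
have -> : [tuple tnth t (r2 i) | i < _] = map_tuple (copair u (tnth w)) (iidx_copair g).
  by apply: eq_from_tnth => i; rewrite tnth_mktuple !tnth_map tnth_rshift.
rewrite -!psat_plug gP; split=> [[Hx Hs] y|H].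
  by rewrite inE => /orP[/eqP->|/Hs].
by split=> [|y ys]; apply: H; rewrite inE ?eqxx ?ys ?orbT.
Qed.

Lemma eqv_plug_exists I n (u v : I -> M) (f : iform I n) : eqv u v ->
  (exists c, psat (plug u f) c) -> exists c, psat (plug v f) c.
Proof. by move=> uv; rewrite /psat /= -!sat_exists_block uv. Qed.

(* The image of tp(w, range u) under the elementary map [u i |-> v i]. *)
Definition push I n (u v : I -> M) (w : n.-tuple M) : set (pform M n) :=
  [set plug v f | f in [set f | psat (plug u f) w]].

Lemma realizes_push I n (u v : I -> M) (w w' : n.-tuple M) :
  realizes w' (push u v w) -> eqv (copair u (tnth w)) (copair v (tnth w')).
Proof.
move=> H; apply/eqv_copairP => f; split=> [Hf|Hf].
  by apply: H; exists f.
apply: contrapT => N; have : psat (plug v (ineg f)) w' by apply: H; exists (ineg f).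
exact.
Qed.

Lemma tp_push I n (u : I -> M) (w : n.-tuple M) : tp w (range u) = push u u w.
Proof.
rewrite predeqE => phi; split=> [[/plug_surj[f ->] Hf]|[f Hf <-]]; first by exists f.
by split=> //; exact: entries_map.
Qed.

Lemma tp_eqv I n (u : I -> M) (w w' : n.-tuple M) :
  tp w (range u) `<=` tp w' (range u) -> eqv (copair u (tnth w)) (copair u (tnth w')).
Proof. by move=> ww'; apply: realizes_push; rewrite -tp_push => phi /ww'[]. Qed.

Section Homogeneity.
Variables (D : forall n, set (set (form L n))) (C : set M).

(** Consistency transfers because a finite part of the type is one formula, and its having a
    realization is a first-order statement about [u]. A realization [c] makes [v, c] equivalent to
    [u, w], which lies in [C], so its types are in [D]. *)
Lemma S_D_push I n (u v : I -> M) (w : n.-tuple M) : D_set D C -> eqv u v ->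
  range u `<=` C -> entries w `<=` C -> S_D D (range v) (push u v w).
Proof.
move=> DC uv uC wC; split; [split; [split|]|].
- by move=> x [_ [f _ <-] xf]; apply: entries_map xf.
- move=> F Ff Fp.
  have /choice[h hP] (phi : pform M n) : exists f : iform I n,
      F phi -> psat (plug u f) w /\ plug v f = phi.
    have [/[dup] /Fp[f ? ?] Fphi|nF] := pselect (F phi); first by exists f.
    by exists (IForm Bot [tuple]).
  have /finite_seqP[s sE] : finite_set (F : set {classic pform M n}) by [].
  have sF phi : F phi <-> (phi : {classic pform M n}) \in s by rewrite sE.
  have [f fP] := iform_conj s h.
  have [|c] := @eqv_plug_exists _ _ _ _ f uv.
    by exists w; apply/fP => phi /sF /hP[].
  by move/fP=> Hc; exists c => phi /[dup] /hP[_ {2}<-] /sF /Hc.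
- move=> phi /plug_surj[f ->].
  have [Hf|Hf] := pselect (psat (plug u f) w); first by left; exists f.
  by right; exists (ineg f).
- move=> c /realizes_push uvc k d dc.
  have [|s ->] := @map_tuple_surj _ _ (copair v (tnth c)) k d; first by rewrite range_copair.
  rewrite (_ : tp0 _ = tp0 (map_tuple (copair u (tnth w)) s)); last first.
    by rewrite predeqE => phi; rewrite /tp0/= (uvc k phi s).
  apply: DC; apply: subset_trans (@entries_map _ _ _ _ _) _.
  by rewrite range_copair => x [/uC|/wC].
Qed.

Variable chi : Type.
Hypothesis C_hom : D_homogeneous D chi C.

(** One forth step of a back-and-forth; below it takes the place of automorphisms of [C]. *)
Lemma homogeneous_extend I n (u v : I -> M) (w : n.-tuple M) :
  card_lt (range v) [set: chi] -> range u `<=` C -> range v `<=` C ->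
  entries w `<=` C -> eqv u v ->
  exists2 w' : n.-tuple M, entries w' `<=` C & eqv (copair u (tnth w)) (copair v (tnth w')).
Proof.
move=> vs uC vC wC uv; have [[_ DC] hom] := C_hom.
have [c cC Hc] := hom _ vC vs _ _ (S_D_push DC uv uC wC).
by exists c => //; exact: realizes_push.
Qed.

End Homogeneity.
End TypeEquivalence.

(** * Rank and stationary extensions *)

Lemma finite_range_tuple X k (w : k.-tuple X) : finite_set (range (tnth w)).
Proof. exact/finite_image/finite_finset. Qed.

Section Rank.
Variables (L : language) (M : structure L) (D : forall n, set (set (form L n))).
Variables (C : set M) (chi : Type).
Hypothesis chi_inf : infinite_set [set: chi].
Hypothesis C_hom : D_homogeneous D chi C.

Let small (A : set M) := card_lt A [set: chi].

Lemma small_range_copair I k (v : I -> M) (w : k.-tuple M) :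
  small (range v) -> small (range (copair v (tnth w))).
Proof.
by move=> vs; rewrite range_copair; apply: card_ltU_finite => //; exact: finite_range_tuple.
Qed.

Lemma plug_extend I n m (u : I -> M) (a : m.-tuple M) (Q : set (iform L I n)) q :
  plug (copair u (tnth a)) @` (@ilift _ I 'I_m n @` Q `|` @ivar _ I n m @` q) =
  plug u @` Q `|` inst q a.
Proof.
rewrite image_setU !image_comp; congr (_ `|` _); apply: eq_imagel => x _ /=.
  exact: plug_lift.
exact: plug_var.
Qed.

(** Induction on the ordinal, enlarging the elementary map at each successor: forth to carry over
    the splitting parameters of clause (a), back to pull the parameters given in clause (b) to the
    side of [u]. *)
Lemma finrank_ge_eqv alpha I n (u v : I -> M) (Q : set (iform L I n)) :
  small (range u) -> small (range v) -> range u `<=` C -> range v `<=` C -> eqv u v ->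
  finrank_ge D C C (plug u @` Q) alpha -> finrank_ge D C C (plug v @` Q) alpha.
Proof.
elim: alpha I n u v Q => [|alpha IH|J Jinh f IH] I n u v Q us vs uC vC uv /=.
- move=> [c cC cu]; have [c' c'C /eqv_copairP uvc] := homogeneous_extend C_hom vs uC vC cC uv.
  by exists c' => // _ [g Qg <-]; apply/uvc/cu; exists g.
- have step m (a a' : m.-tuple M) q : entries a `<=` C -> entries a' `<=` C ->
    eqv (copair u (tnth a)) (copair v (tnth a')) ->
    finrank_ge D C C (plug u @` Q `|` inst q a) alpha ->
    finrank_ge D C C (plug v @` Q `|` inst q a') alpha.
    move=> aC a'C uva; rewrite -!plug_extend; apply: IH => //; try exact: small_range_copair.
      by rewrite range_copair => x [/uC|/aC].
    by rewrite range_copair => x [/vC|/a'C].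
  move=> [[m [phi [a [aC H1 H2]]]] H]; split.
    have [a' a'C uva] := homogeneous_extend C_hom vs uC vC aC uv.
    exists m, phi, a'; split=> //.
      (* A single formula is read as [inst] of a singleton, so that [step] serves both clauses. *)
      by move: H1; rewrite -!(image_set1 (fun phi => PForm phi _)); exact: step.
    by move: H2; rewrite -!(image_set1 (fun phi => PForm phi _)); exact: step.
  move=> k b' b'C.
  have [b bC /eqv_sym uvb] := homogeneous_extend C_hom us vC uC b'C (eqv_sym uv).
  by have [q Dq Hq] := H _ _ bC; exists q => //; exact: step Hq.
- by move=> H i; apply: IH (H i).
Qed.

Lemma rank_geP A n (p : set (pform M n)) alpha :
  rank_ge D C A p alpha <->
  forall q, q `<=` p -> finite_set (dom q) -> finrank_ge D C A q alpha.
Proof.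
split=> [H q qp qf|H B q Bp Bf qB].
  apply: (H (dom q)) => //; first by move=> x [phi /qp]; exists phi.
  by move=> phi qphi; split; [exact: qp | move=> x; exists phi].
apply: H => [phi /qB[]//|]; apply: sub_finite_set Bf => x [phi /qB[_]]; exact.
Qed.

Lemma rank_ge_sub A n (p q : set (pform M n)) alpha :
  p `<=` q -> rank_ge D C A q alpha -> rank_ge D C A p alpha.
Proof. by move=> pq /rank_geP H; apply/rank_geP => r rp; apply: H => phi /rp/pq. Qed.

Lemma rank_ge_eqv I n (u v : I -> M) (c c' : n.-tuple M) alpha :
  small (range u) -> small (range v) -> range u `<=` C -> range v `<=` C ->
  eqv (copair u (tnth c)) (copair v (tnth c')) ->
  rank_ge D C C (tp c (range u)) alpha -> rank_ge D C C (tp c' (range v)) alpha.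
Proof.
move=> us vs uC vC uvc /rank_geP H; apply/rank_geP => q qp qf.
have uv : eqv u v by apply: (eqv_reindex (h := inl)) uvc _ _.
pose Q : set (iform L I n) := [set f | q (plug v f)].
have -> : q = plug v @` Q.
  rewrite predeqE => phi; split=> [/[dup] qphi /qp[/plug_surj[f e] _]|[f ? <-]//].
  by exists f; rewrite // /Q /= -e.
apply: (finrank_ge_eqv us vs uC vC uv); apply: H.
  move=> _ [f /qp[_ Hf] <-]; split; first exact: entries_map.
  by have /eqv_copairP -> := uvc.
(* [h] inverts the elementary map; it is well defined because [eqv] preserves equalities. It shows
   that the pulled back set still has finitely many parameters. *)
have [h hP] : exists h : M -> M, forall i, h (v i) = u i.
  have /choice[h hP] (x : M) : exists y, forall i, v i = x -> u i = y.
    have [[i <-]|ni] := pselect (exists i, v i = x).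
      by exists (u i) => j /(eqv_inj uv).
    by exists x => i vi; case: ni; exists i.
  by exists h => i; rewrite -(hP _ i).
apply: sub_finite_set (finite_image h qf) => _ [_ [f qf' <-] [i _ <-]] /=.
exists (v (tnth (iidx f) i)); last by rewrite hP tnth_map.
by exists (plug v f) => //; exists i => //=; rewrite tnth_map.
Qed.

Lemma eq_rank_sym n (p q : set (pform M n)) : eq_rank D C p q -> eq_rank D C q p.
Proof. by move=> H al; rewrite H. Qed.

Lemma eq_rank_trans n (p q r : set (pform M n)) :
  eq_rank D C p q -> eq_rank D C q r -> eq_rank D C p r.
Proof. by move=> pq qr al; rewrite pq. Qed.

Lemma eq_rank_eqv I n (u v : I -> M) (c c' : n.-tuple M) :
  small (range u) -> small (range v) -> range u `<=` C -> range v `<=` C ->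
  eqv (copair u (tnth c)) (copair v (tnth c')) ->
  eq_rank D C (tp c (range u)) (tp c' (range v)).
Proof.
move=> us vs uC vC uvc al; split; first exact: rank_ge_eqv.
exact/rank_ge_eqv/eqv_sym.
Qed.

(* [tp a A] is the stationary extension of [p]. *)
Definition free n (p : set (pform M n)) (a : n.-tuple M) (A : set M) : Prop :=
  p `<=` tp a A /\ eq_rank D C (tp a A) p.

(** [tp a A'] lies between [p] and [tp a A], and rank can only drop along inclusions. *)
Lemma free_sub n (p : set (pform M n)) a A A' :
  dom p `<=` A' -> A' `<=` A -> free p a A -> free p a A'.
Proof.
move=> pA' AA' [pA eqA].
have pA'a : p `<=` tp a A'.
  by move=> phi pphi; split; [by move=> x ?; apply: pA'; exists phi|move/pA: pphi => []].
split=> // al; split; first exact: rank_ge_sub.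
move/eqA; apply: rank_ge_sub => phi [phiA' ?]; split=> //; exact: subset_trans AA'.
Qed.

(** Push [a] along the map to some [b]. Invariance of rank makes [tp b (range v)] an extension of
    [p] of the same rank, so stationarity identifies it with the type of [a']. *)
Lemma free_range_eqv I n (p : set (pform M n)) (u v : I -> M) a a' :
  stationary D C chi p -> small (range u) -> small (range v) ->
  range u `<=` C -> range v `<=` C ->
  (forall x, dom p x -> exists2 i, u i = x & v i = x) ->
  entries a `<=` C -> entries a' `<=` C ->
  eqv u v -> free p a (range u) -> free p a' (range v) ->
  eqv (copair u (tnth a)) (copair v (tnth a')).
Proof.
move=> p_stat us vs uC vC uvp aC a'C uv [pa pa_eq] [pa' pa'_eq].
have [[_ DC] _] := C_hom.
have pv : dom p `<=` range v by move=> x /uvp[i _ <-]; exists i.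
have [b bC uvb] := homogeneous_extend C_hom vs uC vC aC uv.
apply: (eqv_trans uvb); apply: tp_eqv.
have [q [_ q_uniq]] := p_stat _ vC vs pv.
have tp_S_D (d : n.-tuple M) : entries d `<=` C -> S_D D (range v) (tp d (range v)).
  by move=> dC; rewrite tp_push; exact: (S_D_push DC (@eqv_refl _ _ _ v)).
rewrite -(q_uniq (tp b (range v))); last first.
  split; [exact: tp_S_D | | exact: eq_rank_trans (eq_rank_sym (eq_rank_eqv us vs uC vC uvb)) pa_eq].
  move=> phi pphi; have /pa[/plug_surj[f e]] := pphi; rewrite e => Hf.
  (* The map fixes [dom p] pointwise, so it carries each formula of [p] to itself. *)
  have e' : plug v f = phi.
    rewrite e /plug; congr PForm; apply: eq_from_tnth => i; rewrite !tnth_map.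
    apply/esym.
    have [|j uj <-] := uvp (u (tnth (iidx f) i)); last exact: eqv_inj (eqv_sym uv) uj.
    by exists phi => //; rewrite e; exists i; rewrite //= tnth_map.
  rewrite -e -e'; split; first exact: entries_map.
  by have /eqv_copairP <- := uvb.
by rewrite -(q_uniq (tp a' (range v))) //; split=> //; exact: tp_S_D.
Qed.

Lemma free_exists n (p : set (pform M n)) A :
  stationary D C chi p -> A `<=` C -> small A -> dom p `<=` A ->
  exists2 a, entries a `<=` C & free p a A.
Proof.
move=> p_stat AC As pA; have [q [[Sq pq eq_q] _]] := p_stat _ AC As pA.
have [a aC qa] := C_hom.2 _ AC As _ _ Sq; exists a => //.
rewrite /free; suff -> : tp a A = q by split.
have [[[qA _] qc] _] := Sq.
rewrite predeqE => phi; split=> [[phiA Hphi]|qphi].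
  by have [//|/qa N] := qc _ phiA; case: (N Hphi).
split=> [x xphi|]; last exact: qa.
by apply: qA; exists phi.
Qed.

End Rank.

(** * Order indiscernibles *)

(** Dependent choice with access to the whole past: histories are built as growing lists and read as
    functions on ['I_k]. *)
Lemma sequence_choice X (R : forall k, ('I_k -> X) -> X -> Prop) :
  (forall k y, exists x, R k y x) ->
  exists x : nat -> X, forall k, R k (fun i => x i) (x k).
Proof.
move=> ex; have /choice[h hP] (ky : {k & 'I_k -> X}) : exists x, R (tag ky) (tagged ky) x.
  by case: ky => k y; exact: ex.
have f0 : 'I_0 -> X by case.
pose x0 := h (Tagged (fun k => 'I_k -> X) f0).
pose next s := h (Tagged (fun k => 'I_k -> X) (fun i : 'I_(size s) => nth x0 s i)).
pose s k := iter k (fun s => rcons s (next s)) [::].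
have size_s k : size (s k) = k by elim: k => //= k IH; rewrite size_rcons IH.
have nth_s k i : (i < k)%N -> nth x0 (s k) i = next (s i).
  elim: k => // k IH; rewrite ltnS leq_eqVlt nth_rcons size_s => /orP[/eqP->|ik].
    by rewrite ltnn eqxx.
  by rewrite ik IH.
exists (fun k => next (s k)) => k.
(* The list [s k] has length [k] only up to a proved equation, along which [R] has to be moved. *)
have transport n (y : 'I_n -> X) z : n = k -> (forall i, y i = next (s i)) ->
    R n y z -> R k (fun i => next (s i)) z.
  by move=> nk; move: nk y => <- y /funext ->.
apply: transport (size_s k) _ (hP (Tagged (fun k => 'I_k -> X) _)) => i.
by apply: nth_s; rewrite -[X in (_ < X)%N](size_s k).
Qed.

(** Counting the smaller entries gives equal numbers to equal entries, so repetitions are kept along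
    with the order. This turns finite patterns of rationals into patterns of natural numbers. *)
Lemma order_rank_exists (k : nat) (d : Order.disp_t) (O : orderType d) (t : 'I_k -> O) :
  exists g : 'I_k -> nat, forall i j, (g i < g j)%N = (t i < t j)%O.
Proof.
exists (fun i => #|[pred j | (t j < t i)%O]|) => i j.
case: (ltP (t i) (t j)) => ij; last first.
  apply/negbTE; rewrite -leqNgt; apply: subset_leq_card; apply/fintype.subsetP => l.
  by rewrite !inE => /lt_le_trans; apply.
apply: proper_card; apply/properP; split.
  by apply/fintype.subsetP => l; rewrite !inE => /lt_trans; apply.
by exists i; rewrite !inE ?ij ?ltxx.
Qed.

(** A point strictly inside the current interval becomes its new right end; any other point is
    avoided already. *)
Lemma subinterval_avoiding (ts : seq rat) (l r : rat) : (l < r)%O ->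
  exists l' r', [/\ (l <= l')%O, (l' < r')%O, (r' <= r)%O &
    forall t, t \in ts -> (t <= l')%O \/ (r' <= t)%O].
Proof.
elim: ts => [|t ts IH] lr; first by exists l, r.
have [l' [r' [ll' lr' rr' H]]] := IH lr.
have [tl|lt_t] := leP t l'; last first.
- have [rt|tr] := leP r' t.
    exists l', r'; split=> // x; rewrite inE => /orP[/eqP->|/H//]; by right.
  exists l', t; split=> //; first exact: le_trans (ltW tr) rr'.
  move=> x; rewrite inE => /orP[/eqP->|/H[]]; [by right|by left|].
  by move=> rx; right; exact: le_trans (ltW tr) rx.
- exists l', r'; split=> // x; rewrite inE => /orP[/eqP->|/H//]; by left.
Qed.

(** * Morley sequences of pairs *)

Section Symmetry.
Variables (L : language) (M : structure L) (D : forall n, set (set (form L n))).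
Variables (C : set M) (chi : Type).
Hypothesis chi_inf : infinite_set [set: chi].
Hypothesis C_hom : D_homogeneous D chi C.
Variables (B : set M) (B_sub : B `<=` C) (B_small : card_lt B [set: chi]).
Variables (n m : nat).

Let Cpair := {x : n.-tuple M * m.-tuple M | entries x.1 `<=` C /\ entries x.2 `<=` C}.
Let idB (b : {b | B b}) : M := sval b.

Let fst_sub (x : Cpair) : entries (sval x).1 `<=` C.
Proof. by case: x => x []. Qed.

Let snd_sub (x : Cpair) : entries (sval x).2 `<=` C.
Proof. by case: x => x []. Qed.

(** As [B] is listed identically for every [y], [eqv] of two such families says that the sequences
    have the same type over [B], position by position. *)
Definition over_base K (y : K -> Cpair) : {b | B b} + K * ('I_n + 'I_m) -> M :=
  copair idB (fun ks => copair (tnth (sval (y ks.1)).1) (tnth (sval (y ks.1)).2) ks.2).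

Let range_idB : range idB = B.
Proof.
by rewrite predeqE => x; split=> [[[b ?] _ <-]|Bx] //; exists (exist _ x Bx).
Qed.

Let range_over_base_sub K (y : K -> Cpair) : range (over_base y) `<=` C.
Proof.
move=> _ [[[b Bb]|[k [s|s]]] _ <-] /=; first exact: B_sub.
- by apply: (@fst_sub (y k)); exists s.
- by apply: (@snd_sub (y k)); exists s.
Qed.

Let range_copair_sub I k (u : I -> M) (w : k.-tuple M) :
  range u `<=` C -> entries w `<=` C -> range (copair u (tnth w)) `<=` C.
Proof. by move=> uC wC; rewrite range_copair => x [/uC|/wC]. Qed.

Let small_over_base k (y : 'I_k -> Cpair) : card_lt (range (over_base y)) [set: chi].
Proof.
rewrite range_copair range_idB; apply: card_ltU_finite => //.
exact/finite_image/finite_finset.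
Qed.

Let over_base_comp K K' (h : K' -> K) (y : K -> Cpair) (y' : K -> Cpair) :
  eqv (over_base y) (over_base y') -> eqv (over_base (y \o h)) (over_base (y' \o h)).
Proof.
move=> yy'; apply: (eqv_reindex (h := fun x => match x with
  | inl b => inl b | inr (k, s) => inr (h k, s) end)) yy' _ _;
  by move=> [b|[k s]].
Qed.

(** Lets the pair at [i0] be added last, first component before second, which is the order in which
    types get extended below. *)
Let over_base_lift k (i0 : 'I_k.+1) (y y' : 'I_k.+1 -> Cpair) :
  eqv (copair (copair (over_base (y \o lift i0)) (tnth (sval (y i0)).1))
              (tnth (sval (y i0)).2))
      (copair (copair (over_base (y' \o lift i0)) (tnth (sval (y' i0)).1))
              (tnth (sval (y' i0)).2)) ->
  eqv (over_base y) (over_base y').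
Proof.
move=> yy'; apply: (eqv_reindex (h := fun x => match x with
  | inl b => inl (inl (inl b))
  | inr (i, s) => if unlift i0 i is Some j then inl (inl (inr (j, s)))
                  else match s with inl l => inl (inr l) | inr l => inr l end end)) yy' _ _;
by move=> [b|[i s]] //=; case: unliftP => [j ->|->] //=; case: s.
Qed.

Variables (p : set (pform M n)) (q : set (pform M m)).
Hypotheses (p_stat : stationary D C chi p) (q_stat : stationary D C chi q).
Hypotheses (pB : dom p `<=` B) (qB : dom q `<=` B).

(** The two components are treated unequally: c_k is free over every a_i with i <= k, but a_k only
    over the c_i with i < k. *)
Definition Morley_sequence (x : nat -> Cpair) : Prop := forall k,
  let u := over_base (fun i : 'I_k => x i) in
  free D C p (sval (x k)).1 (range u) /\
  free D C q (sval (x k)).2 (range (copair u (tnth (sval (x k)).1))).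

Lemma Morley_sequence_exists : exists x, Morley_sequence x.
Proof.
apply: (@sequence_choice _ (fun k y (z : Cpair) =>
  free D C p (sval z).1 (range (over_base y)) /\
  free D C q (sval z).2 (range (copair (over_base y) (tnth (sval z).1))))) => k y.
have Bu : B `<=` range (over_base y) by rewrite range_copair range_idB; left.
have [a aC fa] := free_exists C_hom p_stat (@range_over_base_sub _ y) (small_over_base y)
  (subset_trans pB Bu).
have [|c cC fc] := free_exists C_hom q_stat
  (range_copair_sub (@range_over_base_sub _ y) aC)
  (small_range_copair chi_inf _ (small_over_base y)).
  by move=> z /qB/Bu; rewrite range_copair; left.
by exists (exist _ (a, c) (conj aC cC)).
Qed.

Variables (x : nat -> Cpair) (xP : Morley_sequence x).

(** Induction on [k], removing an index [i0] where [g], hence also [g'], is largest. Both components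
    of its pair are free over the rest, so uniqueness of free extensions adds them back one at a
    time. *)
Lemma Morley_eqv k (g g' : 'I_k -> nat) : (forall i j, (g i < g j)%N = (g' i < g' j)%N) ->
  eqv (over_base (x \o g)) (over_base (x \o g')).
Proof.
elim: k g g' => [|k IH] g g' gg'.
  suff -> : over_base (x \o g) = over_base (x \o g') by [].
  by apply/funext => -[b|[[]]].
have [i0 i0P] : exists i0, forall j, (g j <= g i0)%N.
  by case: (@arg_maxnP _ ord0 predT g) => // i0 _ H; exists i0 => j; exact: H.
have i0P' j : (g' j <= g' i0)%N by rewrite leqNgt -gg' -leqNgt.
have {}IH : eqv (over_base (x \o (g \o lift i0))) (over_base (x \o (g' \o lift i0))).
  by apply: IH => i j; exact: gg'.
(* If the maximum is attained again at another index, the pair at [i0] is already among the others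
   and is restored by repeating that index. *)
have [[j gj]|nj] := pselect (exists j, g (lift i0 j) = g i0).
  have gj' : g' (lift i0 j) = g' i0.
    by apply/eqP; rewrite eqn_leq i0P' leqNgt -gg' gj ltnn.
  have := over_base_comp (fun i => odflt j (unlift i0 i)) IH.
  set y := _ \o _; set y' := _ \o _.
  have -> : y = x \o g.
    by apply/funext => i; rewrite /y /=; case: unliftP => [l ->|->] //=; rewrite gj.
  have -> // : y' = x \o g'.
  by apply/funext => i; rewrite /y' /=; case: unliftP => [l ->|->] //=; rewrite gj'.
(* Now all other indices have smaller values, so freeness over the rest is restricted from the whole
   initial segment. *)
have range_sub (f : 'I_k.+1 -> nat) : (forall j, (f (lift i0 j) < f i0)%N) ->
    range (over_base (x \o (f \o lift i0))) `<=` range (over_base (fun i : 'I_(f i0) => x i)).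
  move=> fP _ [[b|[i s]] _ <-]; first by exists (inl b).
  by exists (inr (Ordinal (fP i), s)).
have gi0 j : (g (lift i0 j) < g i0)%N.
  by rewrite ltn_neqAle i0P andbT; apply/eqP => e; apply: nj; exists j.
have g'i0 j : (g' (lift i0 j) < g' i0)%N by rewrite -gg'.
have fixB y y' (z : M) : B z -> exists2 i, @over_base 'I_k y i = z & over_base y' i = z.
  by move=> Bz; exists (inl (exist _ z Bz)).
have free_p f : (forall j, (f (lift i0 j) < f i0)%N) ->
    free D C p (sval (x (f i0))).1 (range (over_base (x \o (f \o lift i0)))).
  move=> fP; apply: free_sub (xP (f i0)).1; last exact: range_sub.
  by rewrite range_copair range_idB => z /pB; left.
have free_q f : (forall j, (f (lift i0 j) < f i0)%N) ->
    free D C q (sval (x (f i0))).2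
      (range (copair (over_base (x \o (f \o lift i0))) (tnth (sval (x (f i0))).1))).
  move=> fP; apply: free_sub (xP (f i0)).2.
    by rewrite !range_copair range_idB => z /qB; do 2 left.
  by rewrite 2!range_copair => z [/(range_sub _ fP)|]; [left|right].
apply: (@over_base_lift _ i0).
have eqv1 := free_range_eqv chi_inf C_hom p_stat (small_over_base _) (small_over_base _)
  (@range_over_base_sub _ _) (@range_over_base_sub _ _) (fun z pz => fixB _ _ z (pB pz))
  (@fst_sub _) (@fst_sub _) IH (free_p _ gi0) (free_p _ g'i0).
apply: (free_range_eqv chi_inf C_hom q_stat _ _ _ _ _ (@snd_sub _) (@snd_sub _) eqv1);
  try exact: free_q; try exact: range_copair_sub;
  try exact/small_range_copair/small_over_base.
by move=> z /qB /fixB -/(_ (x \o (g \o lift i0)) (x \o (g' \o lift i0)))[i ? ?]; exists (inl i).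
Qed.

(** * Stretching to the rationals *)

(** Rationals are treated in the order of their codes. Each finite pattern occurs inside [x], and
    indiscernibility lets homogeneity copy the next pair from there over those already chosen. *)
Lemma Morley_stretch : exists E : rat -> Cpair,
  forall k (t : 'I_k -> rat) (g : 'I_k -> nat), (forall i j, (g i < g j)%N = (t i < t j)%O) ->
  eqv (over_base (E \o t)) (over_base (x \o g)).
Proof.
(* Numbers coding no rational count as [0]; the repetition is harmless since [good] allows equal
   entries. *)
pose r i : rat := odflt (0%R : rat) (unpickle i).
pose good k (y : 'I_k -> Cpair) := forall g : 'I_k -> nat,
  (forall i j, (g i < g j)%N = (r i < r j)%O) -> eqv (over_base y) (over_base (x \o g)).
pose snoc k (y : 'I_k -> Cpair) z (i : 'I_k.+1) := if unlift ord_max i is Some j then y j else z.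
(* The requirement is conditional so that it can be met after any history; that all histories are
   good follows by induction. *)
have [y yP] : exists y : nat -> Cpair, forall k,
    good k (fun i => y i) -> good k.+1 (snoc k (fun i => y i) (y k)).
  apply: (@sequence_choice _ (fun k y z => good k y -> good k.+1 (snoc k y z))) => k y.
  have [gy|ny] := pselect (good k y); last by exists (x 0).
  have [g gP] := order_rank_exists (fun i : 'I_k.+1 => r i).
  have {}gy : eqv (over_base (x \o (g \o lift ord_max))) (over_base y).
    by apply/eqv_sym/gy => i j /=; rewrite gP !lift_max.
  have yC := @range_over_base_sub _ y; have ys := small_over_base y.
  have [a aC eqva] := homogeneous_extend C_hom ys (@range_over_base_sub _ _) yC
    (@fst_sub (x (g ord_max))) gy.
  have [c cC eqvc] := homogeneous_extend C_hom (small_range_copair chi_inf _ ys)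
    (range_copair_sub (@range_over_base_sub _ _) (@fst_sub _)) (range_copair_sub yC aC)
    (@snd_sub (x (g ord_max))) eqva.
  exists (exist _ (a, c) (conj aC cC)) => _ g' g'P.
  apply: (@eqv_trans _ _ _ _ (over_base (x \o g))); last first.
    by apply: Morley_eqv => i j; rewrite gP g'P.
  apply: (@over_base_lift _ ord_max); apply: eqv_sym.
  have e : snoc k y (exist _ (a, c) (conj aC cC)) \o lift ord_max = y.
    by apply/funext => i; rewrite /snoc /= liftK.
  by rewrite e /snoc unlift_none.
have good_y k : good k (fun i => y i).
  elim: k => [|k /yP].
    move=> g _; suff -> : over_base (fun i : 'I_0 => y i) = over_base (x \o g) by [].
    by apply/funext => -[b|[[]]].
  suff -> : snoc k (fun i => y i) (y k) = (fun i => y i) by [].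
  apply/funext => i; rewrite /snoc; case: unliftP => [j ->|->] //.
  by rewrite lift_max.
exists (y \o pickle) => k t g gP.
(* [N] exceeds all codes of the [t i], so [E \o t] is read off from the first [N] choices. *)
pose N := (\max_(i < k) pickle (t i)).+1.
have ltN i : (pickle (t i) < N)%N by rewrite ltnS; exact: leq_bigmax.
have [g' g'P] := order_rank_exists (fun i : 'I_N => r i).
have := over_base_comp (fun i => Ordinal (ltN i)) (good_y N g' g'P).
move=> /eqv_trans; apply; apply: Morley_eqv => i j.
by rewrite gP /= g'P /r /= !pickleK.
Qed.

Lemma over_base_copair K K' (y : K -> Cpair) (y' : K' -> Cpair) (h : 'I_2 -> K) (h' : 'I_2 -> K') :
  eqv (over_base (y \o h)) (over_base (y' \o h')) ->
  eqv (copair (copair idB (tnth (sval (y (h ord0))).2)) (tnth (sval (y (h ord_max))).1))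
      (copair (copair idB (tnth (sval (y' (h' ord0))).2)) (tnth (sval (y' (h' ord_max))).1)).
Proof.
move=> yy'; apply: (eqv_reindex (h := fun s => match s with
  | inl (inl b) => inl b | inl (inr l) => inr (ord0, inr l)
  | inr l => inr (ord_max, inl l) end)) yy' _ _; by move=> [[b|l]|l].
Qed.

(** * Infinite rank from a dense order *)

Variables (E : rat -> Cpair).
Hypothesis E_x : forall k (t : 'I_k -> rat) (g : 'I_k -> nat),
  (forall i j, (g i < g j)%N = (t i < t j)%O) -> eqv (over_base (E \o t)) (over_base (x \o g)).

(** [d] involves only finitely many rationals. On an interval free of them, all [t] have the same
    position relative to [d], and indiscernibility applies. *)
Let E_tp0 k (d : k.-tuple M) (l r : rat) : entries d `<=` range (over_base E) -> (l < r)%O ->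
  exists l' r', [/\ (l <= l')%O, (l' < r')%O, (r' <= r)%O & forall t t',
    (l' < t)%O -> (t < r')%O -> (l' < t')%O -> (t' < r')%O ->
    tp0 (cat_tuple (sval (E t)).1 d) = tp0 (cat_tuple (sval (E t')).1 d)].
Proof.
move=> /map_tuple_surj[s ->] lr.
(* Entries from [B] involve no rational; the default [l] puts no constraint on a subinterval. *)
pose ts := [seq if tnth s j is inr (w, _) then w else l | j : 'I_k].
have [l' [r' [ll' lr' rr' ts_avoid]]] := subinterval_avoiding ts lr.
exists l', r'; split=> // t t' lt tr lt' tr'.
(* [tau z] lists [z] and then the rationals of [d]. The default [l'] lies outside the open interval,
   so replacing [t] by [t'] changes no comparison. *)
pose tau z (i : 'I_k.+1) := if unlift ord0 i is Some j
  then if tnth s j is inr (w, _) then w else l' else z.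
have tau0 z : tau z ord0 = z by rewrite /tau unlift_none.
have tauS z j : tau z (lift ord0 j) = tau l' (lift ord0 j) by rewrite /tau liftK.
have tau_avoid z j : (tau z (lift ord0 j) <= l')%O \/ (r' <= tau z (lift ord0 j))%O.
  rewrite /tau liftK; case e: (tnth s j) => [b|[w v]]; first by left.
  apply: ts_avoid; apply/fintype.imageP; exists j => //; by rewrite e.
have tau_lt i j : (tau t i < tau t j)%O = (tau t' i < tau t' j)%O.
  have above z w : (l' < z)%O -> (z < r')%O -> (w <= l')%O \/ (r' <= w)%O ->
      (z < w)%O = (r' <= w)%O /\ (w < z)%O = (w <= l')%O.
    move=> lz zr [wl|rw]; split.
    - by rewrite [LHS]ltNge [RHS]leNgt (ltW (le_lt_trans wl lz)) (le_lt_trans wl lr').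
    - by rewrite wl (le_lt_trans wl lz).
    - by rewrite rw (lt_le_trans zr rw).
    - by rewrite [LHS]ltNge [RHS]leNgt (ltW (lt_le_trans zr rw)) (lt_le_trans lr' rw).
  case: (unliftP ord0 i) => [i' ->|->]; case: (unliftP ord0 j) => [j' ->|->].
  - by rewrite !(tauS t) !(tauS t').
  - rewrite !tau0 (tauS t) (tauS t').
    by rewrite (above _ _ lt tr (tau_avoid _ _)).2 (above _ _ lt' tr' (tau_avoid _ _)).2.
  - rewrite !tau0 (tauS t) (tauS t').
    by rewrite (above _ _ lt tr (tau_avoid _ _)).1 (above _ _ lt' tr' (tau_avoid _ _)).1.
  - by rewrite !ltxx.
have [g gP] := order_rank_exists (tau t).
have tt' : eqv (over_base (E \o tau t)) (over_base (E \o tau t')).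
  apply: (@eqv_trans _ _ _ _ (over_base (x \o g))); first exact: E_x.
  by apply/eqv_sym/E_x => i j; rewrite gP tau_lt.
pose sigma : (n + k).-tuple ({b | B b} + 'I_k.+1 * ('I_n + 'I_m)) :=
  cat_tuple [tuple inr (ord0, inl i) | i < n]
    [tuple match tnth s j with inl b => inl b | inr (_, v) => inr (lift ord0 j, v) end | j < k].
have catE z : cat_tuple (sval (E z)).1 (map_tuple (over_base E) s) =
    map_tuple (over_base (E \o tau z)) sigma.
  apply: eq_from_tnth => i; rewrite tnth_map; case: (split_ordP i) => j ->.
    by rewrite !tnth_lshift tnth_mktuple /= tau0.
  rewrite !tnth_rshift tnth_mktuple tnth_map.
  by case e: (tnth s j) => [b|[w v]] //=; rewrite /tau liftK e.
by rewrite predeqE => phi; rewrite !catE; exact: tt'.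
Qed.

(* Density of the order gives clause (a) of the rank by cutting the interval at
   a middle point, and clause (b) by shrinking it to avoid finitely many points. *)
Lemma dense_order_finrank_ge (f : iform L ({b | B b} + 'I_m) n) :
  (forall s t, (s < t)%O -> psat (plug (copair idB (tnth (sval (E s)).2)) f) (sval (E t)).1) ->
  (forall s t, (t < s)%O -> ~ psat (plug (copair idB (tnth (sval (E s)).2)) f) (sval (E t)).1) ->
  forall alpha (P : set (pform M n)) (l r : rat), (l < r)%O ->
  (forall t, (l < t)%O -> (t < r)%O -> realizes (sval (E t)).1 P) ->
  finrank_ge D C (range (over_base E)) P alpha.
Proof.
move=> f_lt f_gt; have [[_ DC] _] := C_hom.
have mid (l r : rat) : (l < r)%O -> exists2 s, (l < s)%O & (s < r)%O.
  by move=> lr; exists ((l + r) / 2%:R)%R; have [] := Num.Theory.midf_lt lr.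
have realizesU z (P Q : set (pform M n)) : realizes z P -> realizes z Q -> realizes z (P `|` Q).
  by move=> zP zQ phi [/zP|/zQ].
elim=> [|alpha IH|J _ g IH] P l r lr P_lr /=.
- have [s ls sr] := mid _ _ lr.
  by exists (sval (E s)).1; [exact: fst_sub | exact: P_lr].
- split=> [|k d dE].
    have [s ls sr] := mid _ _ lr.
    pose u := copair idB (tnth (sval (E s)).2).
    exists (ipar f), (imatrix f), (map_tuple u (iidx f)); split.
    + apply: subset_trans (@entries_map _ _ _ _ _) _ => _ [[b|j] _ <-].
        by exists (inl b).
      by exists (inr (s, inr j)).
    + apply: (IH _ s r sr) => t st tr; apply: realizesU.
        by apply: P_lr => //; exact: lt_trans st.
      by move=> _ ->; exact: f_lt.
    + apply: (IH _ l s ls) => t lt ts; apply: realizesU.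
        by apply: P_lr => //; exact: lt_trans sr.
      by move=> _ ->; exact: f_gt.
  have [l' [r' [ll' lr' rr' H]]] := E_tp0 dE lr.
  have [s ls sr] := mid _ _ lr'.
  (* The type shared by the whole subinterval; it is in [D] because [C] is a [D]-set. *)
  exists (tp0 (cat_tuple (sval (E s)).1 d)).
    apply: DC => y [i _ <-]; case: (split_ordP i) => j ->.
      by rewrite tnth_lshift; apply: (@fst_sub (E s)); exists j.
    by rewrite tnth_rshift; apply/range_over_base_sub/dE; exists j.
  apply: (IH _ l' r' lr') => t lt tr; apply: realizesU.
    by apply: P_lr; [exact: le_lt_trans lt | exact: lt_le_trans rr'].
  move=> _ [phi phiE <-]; rewrite (H _ t) // in phiE; exact: phiE.
- by move=> i; apply: IH lr P_lr.
Qed.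

(** A formula over [B] telling the two sides apart would order [E], and then already the empty type
    would have infinite rank over [range (over_base E)]. *)
Lemma Morley_pair_eqv : totally_transcendental D C ->
  eqv (copair (copair idB (tnth (sval (x 0)).2)) (tnth (sval (x 1)).1))
      (copair (copair idB (tnth (sval (x 1)).2)) (tnth (sval (x 0)).1)).
Proof.
move=> D_tt; apply/eqv_copairP; apply: contrapT => /existsNP[f0 f0P].
(* Up to negation, the formula holds when the second component comes from the earlier pair. *)
have [f f1 f2] : exists2 f : iform L ({b | B b} + 'I_m) n,
    psat (plug (copair idB (tnth (sval (x 0)).2)) f) (sval (x 1)).1 &
    ~ psat (plug (copair idB (tnth (sval (x 1)).2)) f) (sval (x 0)).1.
  have [H|H] := pselect (psat (plug (copair idB (tnth (sval (x 0)).2)) f0) (sval (x 1)).1).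
    by exists f0 => // H'; apply: f0P.
  by exists (ineg f0) => // H'; apply: f0P; split=> // /H'.
have E_eqv (s t : rat) (i j : nat) : (i < j)%N = (s < t)%O -> (j < i)%N = (t < s)%O ->
    eqv (copair (copair idB (tnth (sval (E s)).2)) (tnth (sval (E t)).1))
        (copair (copair idB (tnth (sval (x i)).2)) (tnth (sval (x j)).1)).
  move=> ij ji; pose two X (y z : X) (l : 'I_2) := if l == ord0 then y else z.
  apply: (over_base_copair (h := two _ s t) (h' := two _ i j)); apply: E_x => l l'.
  by rewrite /two; case: ifP; case: ifP; rewrite ?ltxx ?ltnn.
have f_lt s t : (s < t)%O -> psat (plug (copair idB (tnth (sval (E s)).2)) f) (sval (E t)).1.
  by move=> st; have /eqv_copairP -> := E_eqv s t 0 1 (esym st) (esym (lt_gtF st)).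
have f_gt s t : (t < s)%O -> ~ psat (plug (copair idB (tnth (sval (E s)).2)) f) (sval (E t)).1.
  by move=> ts; have /eqv_copairP -> := E_eqv s t 1 0 (esym (lt_gtF ts)) (esym ts).
have infinite_rank : rank_infinite D C (range (over_base E)) (set0 : set (pform M n)).
  move=> alpha; apply/rank_geP => Q Q0 _.
  by apply: (dense_order_finrank_ge f_lt f_gt alpha Num.Theory.ltr01) => t _ _ phi /Q0.
apply: D_tt infinite_rank; first exact: range_over_base_sub.
split; first by move=> y [].
by move=> F _ F0; exists (sval (x 0)).1 => phi /F0.
Qed.

End Symmetry.

(** * Symmetry of independence *)

(** Independence of [a] from [c] and stationarity identify (a_1, c_0) with (a, c) over [B]. Since
    (a_0, c_1) has the type of (a_1, c_0), it has that of (a, c) too, and c_1 is free over a_0. *)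
Lemma indep_sym L (M : structure L) (D : forall n, set (set (form L n))) (C : set M) chi
  (chi_inf : infinite_set [set: chi]) (C_hom : D_homogeneous D chi C)
  (D_tt : totally_transcendental D C)
  (B : set M) (B_sub : B `<=` C) (B_small : card_lt B [set: chi])
  n m (a : n.-tuple M) (c : m.-tuple M) (a_in : entries a `<=` C) (c_in : entries c `<=` C)
  (a_stat : stationary D C chi (tp a B)) (c_stat : stationary D C chi (tp c B)) :
  indep D C a B c -> indep D C c B a.
Proof.
move=> ac.
have dom_tp k (b : k.-tuple M) : dom (tp b B) `<=` B by move=> y [phi [phiB _]] /phiB.
have tp_mono k (b : k.-tuple M) A A' : A `<=` A' -> tp b A `<=` tp b A'.
  by move=> AA' phi [phiA ?]; split=> //; exact: subset_trans AA'.
have [x xP] := Morley_sequence_exists chi_inf C_hom B_sub B_small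
  a_stat c_stat (@dom_tp _ a) (@dom_tp _ c).
have [E EP] := Morley_stretch chi_inf C_hom B_sub B_small
  a_stat c_stat (@dom_tp _ a) (@dom_tp _ c) xP.
have x_eqv := Morley_pair_eqv C_hom B_sub EP D_tt.
pose idB (b : {b | B b}) : M := sval b.
have range_idB : range idB = B.
  by rewrite predeqE => y; split=> [[[b ?] _ <-]|By] //; exists (exist _ y By).
have idBC : range idB `<=` C by rewrite range_idB.
have small_idB : card_lt (range idB) [set: chi] by rewrite range_idB.
have x_fst i : entries (sval (x i)).1 `<=` C by case: (x i) => y [].
have x_snd i : entries (sval (x i)).2 `<=` C by case: (x i) => y [].
have range_sub k (b : k.-tuple M) : entries b `<=` C -> range (copair idB (tnth b)) `<=` C.
  by move=> bC; rewrite range_copair => y [/idBC|/bC].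
have small_range k (b : k.-tuple M) : card_lt (range (copair idB (tnth b))) [set: chi].
  exact: small_range_copair.
have tp_idB k (b b' : k.-tuple M) A : free D C (tp b B) b' A ->
    eqv (copair idB (tnth b)) (copair idB (tnth b')).
  by move=> [bb' _]; apply: tp_eqv; rewrite range_idB => phi /[dup] -[phiB _] /bb'[].
have fixB y k (b b' : k.-tuple M) : B y ->
    exists2 i, copair idB (tnth b) i = y & copair idB (tnth b') i = y.
  by move=> By; exists (inl (exist _ y By)).
have free_a1 : free D C (tp a B) (sval (x 1)).1 (range (copair idB (tnth (sval (x 0)).2))).
  apply: free_sub (xP 1).1 => [y /dom_tp By|y [[b|s] _ <-]].
  - by have [i <-] := fixB y _ (sval (x 0)).2 (sval (x 0)).2 By; exists i.
  - by exists (inl b).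
  - by exists (inr (ord0, inr s)).
have free_a : free D C (tp a B) a (range (copair idB (tnth c))).
  rewrite range_copair range_idB; split; last exact: eq_rank_sym ac.
  by apply: tp_mono; left.
have free_c1 : free D C (tp c B) (sval (x 1)).2 (range (copair idB (tnth (sval (x 0)).1))).
  apply: free_sub (xP 1).2 => [y /dom_tp By|y [[b|s] _ <-]].
  - by have [i <-] := fixB y _ (sval (x 0)).1 (sval (x 0)).1 By; exists i.
  - by exists (inl (inl b)).
  - by exists (inl (inr (ord0, inl s))).
have c_c0 := tp_idB _ _ _ _ (xP 0).2.
(* The map fixing [B] and taking c_0 to [c] matches the free extensions realized by a_1 and by
   [a]. *)
have a1_c0 := free_range_eqv chi_inf C_hom a_stat (small_range _ _) (small_range _ _)
  (range_sub _ _ (@x_snd 0)) (range_sub _ _ c_in)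
  (fun y ya => fixB y _ (sval (x 0)).2 c (dom_tp _ _ _ ya)) (@x_fst 1) a_in
  (eqv_sym c_c0) free_a1 free_a.
have a0_c1 := eqv_trans (eqv_sym x_eqv) a1_c0.
have c1_a0 : eqv (copair (copair idB (tnth (sval (x 0)).1)) (tnth (sval (x 1)).2))
                 (copair (copair idB (tnth a)) (tnth c)).
  apply: (eqv_reindex (h := fun s => match s with
    | inl (inl b) => inl (inl b) | inl (inr l) => inr l
    | inr l => inl (inr l) end)) a0_c1 _ _; by move=> [[b|l]|l].
rewrite /indep -[B in B `|` _]range_idB -range_copair.
(* The rank of [tp c B] is that of c_1 over [B] and a_0, which [c1_a0] carries to [c] over [B] and
   [a]. *)
apply: eq_rank_trans (eq_rank_sym free_c1.2) _.
apply: (eq_rank_eqv chi_inf C_hom) c1_a0 => //; exact: range_sub.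
Qed.

Theorem theorem3p20
  (L : language) (T : set (form L 0))
  (M : structure L) (M_models : models M T) (M_sat : saturated M)
  (D : forall n, set (set (form L n)))
  (D_sub : forall n, D n `<=` @types_of L T n)
  (chi : Type)
  (chi_gt_T : card_lt [set: {n : nat & form L n}] [set: chi])
  (C : set M) (C_hom : D_homogeneous D chi C) (C_card : [set: chi] #<= C)
  (D_tt : totally_transcendental D C)
  (B : set M) (B_sub : B `<=` C) (B_small : card_lt B [set: chi])
  (n m : nat) (a : n.-tuple M) (c : m.-tuple M)
  (a_in : entries a `<=` C) (c_in : entries c `<=` C)
  (a_stat : stationary D C chi (tp a B))
  (c_stat : stationary D C chi (tp c B)) :
  indep D C a B c <-> indep D C c B a.
Proof.
have chi_inf : infinite_set [set: chi].
  move=> /(card_le_finite chi_gt_T.1); rewrite finite_setPn; apply.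
  (* One copy of [Bot] for each number of free variables already gives infinitely many formulas. *)
  pose bot n := existT (form L) n Bot.
  apply: card_le_trans (subset_card_le (@subsetT _ (range bot))).
  have bot_inj : {in [set: nat] &, injective bot} by move=> i j _ _ [].
  by have := inj_card_eq bot_inj; rewrite card_eq_sym card_eq_le => /andP[].
by split; apply: (indep_sym chi_inf C_hom D_tt B_sub B_small).
Qed.
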